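(* Consider a stochastic hybrid system (SHS) with continuous state $x(t)\in\mathbb{R}^n$ and discrete state $q(t)\in Q=\{s_1,\dots,s_N\}$, given by the stochastic differential equation $dx=f(q,x)\,dt+g(q,x)\,dw$, transition intensities $\lambda_r(q,x)$, and reset maps $(q,x)\mapsto(\theta_r(q),\phi_r(q,x))$, $r=1,\dots,\mathcal{R}$. Let $b=(b_1,\dots,b_N)\in\mathbb{R}^N$ be defined by $b_i=1$ if $q=s_i$ and $b_i=0$ otherwise. Consider the SHS with a single discrete mode and state $(b,x)\in\mathbb{R}^{N+n}$ described by the continuous dynamics $$d\begin{bmatrix} b\\ x\end{bmatrix}=\begin{bmatrix}0\\ \sum_{i=1}^N b_i f(s_i,x)\end{bmatrix}dt+\begin{bmatrix}0\\ \sum_{i=1}^N b_i g(s_i,x)\,dw\end{bmatrix},$$ the reset intensities $$\sum_{i=1}^N b_i\lambda_r(s_i,x),\qquad r=1,\dots,\mathcal{R},$$ and the reset maps $$(b,x)\mapsto\Big(b-\sum_{i=1}^N b_i\,e_{s_i}+\sum_{i=1}^N b_i\,e_{\theta_r(s_i)},\ \sum_{i=1}^N b_i\,\phi_r(s_i,x)\Big),\qquad r=1,\dots,\mathcal{R}.$$ Then this single-mode SHS recasts the original SHS in $(b,x)$ space. That is, under the identification of the discrete state $q=s_j$ with $b=e_{s_j}$, for every $s_j\in Q$ and every $x\in\mathbb{R}^n$ the continuous dynamics of $x$, the reset intensities, and the reset maps of the single-mode SHS at $(e_{s_j},x)$ coincide with those of the original SHS at $(s_j,x)$; in particular, the reset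 map sends $(e_{s_j},x)$ to $(e_{\theta_r(s_j)},\phi_r(s_j,x))$, and $b$ is constant between resets.
   Context: Here $f:Q\times\mathbb{R}^n\to\mathbb{R}^n$ is the drift, $g:Q\times\mathbb{R}^n\to\mathbb{R}^{n\times k}$ the diffusion coefficient, and $w$ a $k$-dimensional Wiener process. The state $(q,x)$ evolves by the SDE between resets (with $q$ constant). There are $\mathcal{R}$ types of resets. Reset $r$ occurs with state-dependent intensity $\lambda_r:Q\times\mathbb{R}^n\to[0,\infty)$, and when it occurs the state changes from $(q,x)$ to $(\theta_r(q),\phi_r(q,x))$, where $\theta_r:Q\to Q$ and $\phi_r:Q\times\mathbb{R}^n\to\mathbb{R}^n$. The vector $e_{s_i}\in\mathbb{R}^N$ denotes the standard unit vector with entry $1$ in position $i$ and zeros elsewhere. By definition $b$ satisfies $\sum_{i=1}^N b_i=1$, $b_ib_j=0$ for $i\neq j$, and $b_i^2=b_i$. A single-mode SHS is one with only one discrete state, so the discrete state is dropped from the notation. *)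

(* Defs.v *)
From HB Require Import structures.
From mathcomp Require Import all_boot all_order all_algebra.
From mathcomp Require Import all_classical all_reals all_analysis.

Set Implicit Arguments.
Unset Strict Implicit.
Unset Printing Implicit Defensive.

Import Order.TTheory GRing.Theory Num.Theory numFieldNormedType.Exports.

Local Open Scope classical_set_scope.
Local Open Scope ring_scope.

(** Data of a stochastic hybrid system with discrete states [Q], continuous
    states in R^n, a [k]-dimensional driving noise and [m] types of resets.
    Intensities are plain real-valued functions here: the multilinear
    expressions of the single-mode system below are defined, but possibly
    negative, at points (b, x) where b is not a unit vector. *)
Record shs (R : realType) (Q : Type) (n k m : nat) := SHS {
  drift : Q -> 'cV[R]_n -> 'cV[R]_n ;
  diffusion : Q -> 'cV[R]_n -> 'M[R]_(n, k) ;
  intensity : 'I_m -> Q -> 'cV[R]_n -> R ;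
  reset_mode : 'I_m -> Q -> Q ;
  reset_state : 'I_m -> Q -> 'cV[R]_n -> 'cV[R]_n }.

(** The vector b attached to the discrete state [q], for the enumeration
    s_1, ..., s_N of Q given by [s]; it is also the vector written e_q. *)
Definition mode_vec (R : realType) (Q : eqType) (N : nat) (s : 'I_N -> Q)
  (q : Q) : 'cV[R]_N := \col_i (q == s i)%:R.

Lemma mode_vecE (R : realType) (Q : eqType) (N : nat) (s : 'I_N -> Q)
  (s_inj : injective s) (j : 'I_N) : mode_vec R s (s j) = delta_mx j 0.
Proof.
by apply/matrixP => i l; rewrite !mxE ord1 eqxx andbT (inj_eq s_inj) eq_sym.
Qed.

(** A state of the single-mode system is [col_mx b x]; its only mode is [tt]. *)
Definition recast (R : realType) (Q : eqType) (N n k m : nat) (s : 'I_N -> Q)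
  (H : shs R Q n k m) : shs R unit (N + n) k m := {|
  drift := fun _ z => let b := usubmx z in let x := dsubmx z in
    col_mx 0 (\sum_(i < N) b i 0 *: drift H (s i) x) ;
  diffusion := fun _ z => let b := usubmx z in let x := dsubmx z in
    col_mx 0 (\sum_(i < N) b i 0 *: diffusion H (s i) x) ;
  intensity := fun r _ z => let b := usubmx z in let x := dsubmx z in
    \sum_(i < N) b i 0 * intensity H r (s i) x ;
  reset_mode := fun _ _ => tt ;
  reset_state := fun r _ z => let b := usubmx z in let x := dsubmx z in
    col_mx (b - \sum_(i < N) b i 0 *: mode_vec R s (s i)
              + \sum_(i < N) b i 0 *: mode_vec R s (reset_mode H r (s i)))
           (\sum_(i < N) b i 0 *: reset_state H r (s i) x) |}.

(** Time is R restricted to [0, +oo[; values at negative times are irrelevant. *)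
Record filtration (R : realType) (d : measure_display)
  (Omega : measurableType d) (F : R -> set_system Omega) : Prop := {
  filtration_sigma : forall t : R, 0 <= t -> sigma_algebra setT (F t) ;
  filtration_measurable : forall t : R, 0 <= t -> F t `<=` measurable ;
  filtration_homo : forall t1 t2 : R, 0 <= t1 -> t1 <= t2 -> F t1 `<=` F t2 }.

Definition meas_wrt (R : realType) (Omega : Type) (G : set_system Omega)
  (f : Omega -> R) : Prop := forall B : set R, measurable B -> G (f @^-1` B).

(** [w] is a [k]-dimensional standard Wiener process relative to [F]: given
    F_t1, the coordinates of w_t2 - w_t1 are independent N(0, t2 - t1). *)
Record wiener_process (R : realType) (d : measure_display)
  (Omega : measurableType d) (P : probability Omega R)
  (F : R -> set_system Omega) (k : nat) (w : R -> Omega -> 'cV[R]_k)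
  : Prop := {
  wiener_filtration : filtration F ;
  wiener_adapted : forall (t : R) a, 0 <= t -> meas_wrt (F t) (fun o => w t o a 0) ;
  wiener_start : {ae P, forall o, w 0 o = 0} ;
  wiener_continuous : {ae P, forall o, forall a,
    {within `[0, +oo[, continuous (fun t => w t o a 0)}} ;
  wiener_increments : forall (t1 t2 : R) (A : set Omega) (B : 'I_k -> set R),
    0 <= t1 -> t1 < t2 -> F t1 A -> (forall a, measurable (B a)) ->
    P (A `&` [set o | forall a, B a (w t2 o a 0 - w t1 o a 0)])
    = (P A * \prod_(a < k) normal_prob 0 (Num.sqrt (t2 - t1)) (B a))%E }.

(** Elementary integrand: sum over i < [sp_size] of [sp_val i] on
    the interval ]sp_time i, sp_time (i+1)]. *)
Record simple_process (R : realType) (Omega : Type) (F : R -> set_system Omega)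
  (k : nat) := SimpleProcess {
  sp_size : nat ;
  sp_time : nat -> R ;
  sp_val : nat -> Omega -> 'rV[R]_k ;
  sp_time_ge0 : 0 <= sp_time 0 ;
  sp_time_homo : forall i, sp_time i <= sp_time i.+1 ;
  sp_adapted : forall i a, meas_wrt (F (sp_time i)) (fun o => sp_val i o 0 a) ;
  sp_bounded : exists C : R, forall i o a, `|sp_val i o 0 a| <= C }.

Definition sp_eval (R : realType) (Omega : Type) (F : R -> set_system Omega)
  (k : nat) (Y : simple_process F k) (u : R) (o : Omega) : 'rV[R]_k :=
  \sum_(i < sp_size Y) ((sp_time Y i < u <= sp_time Y i.+1)%R : bool)%:R *: sp_val Y i o.

Definition sp_integral (R : realType) (Omega : Type)
  (F : R -> set_system Omega) (k : nat) (w : R -> Omega -> 'cV[R]_k)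
  (Y : simple_process F k) (t : R) (o : Omega) : R :=
  \sum_(i < sp_size Y)
    (sp_val Y i o *m (w (Num.min (sp_time Y i.+1) t) o
                      - w (Num.min (sp_time Y i) t) o)) 0 0.

(** Convergence to 0 in probability of nonnegative random variables. *)
Definition cvg0_in_prob (R : realType) (d : measure_display)
  (Omega : measurableType d) (P : probability Omega R)
  (Z : nat -> Omega -> \bar R) : Prop :=
  forall eps : R, 0 < eps ->
    (fun i => P [set o | (eps%:E < Z i o)%E]) @ \oo --> 0%E.

Definition sp_approximates (R : realType) (d : measure_display)
  (Omega : measurableType d) (P : probability Omega R)
  (F : R -> set_system Omega) (k : nat)
  (Z : nat -> simple_process F k) (Y : R -> Omega -> 'rV[R]_k) : Prop :=
  forall t : R, 0 <= t -> cvg0_in_prob P (fun i o =>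
    \int[lebesgue_measure]_(u in `[0%R, t])
      (\sum_(a < k) (sp_eval (Z i) u o 0 a - Y u o 0 a) ^+ 2)%:E)%E.

(** [M] is a continuous version of the Ito integral process t |-> int_0^t Y dw:
    [Y] is approximated by simple processes, and the integrals of any such
    approximation converge to [M] in probability. *)
Record ito_integral (R : realType) (d : measure_display)
  (Omega : measurableType d) (P : probability Omega R)
  (F : R -> set_system Omega) (k : nat) (w : R -> Omega -> 'cV[R]_k)
  (Y : R -> Omega -> 'rV[R]_k) (M : R -> Omega -> R) : Prop := {
  ito_adapted : forall (t : R) a, 0 <= t -> meas_wrt (F t) (fun o => Y t o 0 a) ;
  ito_measurable : forall a,
    measurable_fun ((`[0, +oo[ : set R) `*` [set: Omega])
      (fun p : R * Omega => Y p.1 p.2 0 a) ;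
  ito_rv : forall t : R, 0 <= t -> measurable_fun setT (M t) ;
  ito_continuous : {ae P, forall o, {within `[0, +oo[, continuous (M ^~ o)}} ;
  ito_approximable : exists Z : nat -> simple_process F k,
    sp_approximates P Z Y ;
  ito_limit : forall Z : nat -> simple_process F k, sp_approximates P Z Y ->
    forall t : R, 0 <= t ->
      cvg0_in_prob P (fun i o => `|sp_integral w (Z i) t o - M t o|%:E) }.

(** The process (q, x) evolves according to [H] between resets, [T o] being the
    set of reset times of the sample path [o]: almost surely, on each [t1, t2]
    with no reset in ]t1, t2], q is constant and
    dx = drift(q, x) dt + diffusion(q, x) dw. Values at a reset time are those
    taken just after the reset. *)
Record evolves_between_resets (R : realType) (Q : Type) (n k m : nat)
  (H : shs R Q n k m) (d : measure_display) (Omega : measurableType d)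
  (P : probability Omega R) (F : R -> set_system Omega)
  (w : R -> Omega -> 'cV[R]_k) (T : Omega -> set R)
  (q : R -> Omega -> Q) (x : R -> Omega -> 'cV[R]_n) : Prop := {
  evolves_adapted_mode : forall (t : R) p, 0 <= t -> F t [set o | q t o = p] ;
  evolves_adapted_state : forall (t : R) a, 0 <= t ->
    meas_wrt (F t) (fun o => x t o a 0) ;
  evolves_drift : {ae P, forall o, forall a (t : R), 0 <= t ->
    lebesgue_measure.-integrable `[0, t]
      (fun u => (drift H (q u o) (x u o) a 0)%:E)} ;
  evolves_mode : {ae P, forall o, forall t1 t2 : R, 0 <= t1 -> t1 <= t2 ->
    T o `&` `]t1, t2] = set0 -> q t2 o = q t1 o} ;
  evolves_state : forall a, exists2 M : R -> Omega -> R,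
    ito_integral P F w (fun u o => row a (diffusion H (q u o) (x u o))) M &
    {ae P, forall o, forall t1 t2 : R, 0 <= t1 -> t1 <= t2 ->
      T o `&` `]t1, t2] = set0 ->
      x t2 o a 0 - x t1 o a 0 =
        (\int[lebesgue_measure]_(u in `[t1, t2])
            (drift H (q u o) (x u o) a 0)) + (M t2 o - M t1 o)} }.

(* Main.v *)
Require Import Defs.
From HB Require Import structures.
From mathcomp Require Import all_boot all_order all_algebra.
From mathcomp Require Import all_classical all_reals all_analysis.

(** At b = e_q with q = s_j, a combination of the vectors v_1, ..., v_N with
    coefficients b_1, ..., b_N picks out v_j.  Applied to each ingredient of
    the single-mode system, this gives the algebraic part of the claim; in the
    reset map, b minus the sum of the b_i e_(s_i) vanishes and only the new
    unit vector is left ([sum_mode_vec]).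

    The constancy of b between resets is a statement about stochastic
    processes.  The rows of the drift and of the diffusion coefficient which
    belong to b are zero, so an increment of b_i between resets is an increment
    of an Ito integral M of the zero integrand.  Such an M vanishes:
    the simple process without steps approximates the zero integrand, so its
    integrals, which are 0, converge in probability to M_t, whence M_t = 0
    almost surely for each fixed t ([ito_integral0_at]).  The exceptional null
    set depends on t.  Collecting those of the countably many rational times
    and using the continuity of the paths of M yields one null set outside of
    which M vanishes at all times ([ito_integral0]). *)

Import Order.TTheory GRing.Theory Num.Theory numFieldNormedType.Exports.

Local Open Scope classical_set_scope.
Local Open Scope ring_scope.

(** Stated for scalings in a module, so that with the regular module R^o it
    also covers the scalar combination in the reset intensities. *)
Lemma sum_mode_vec {R : realType} {Q : eqType} {N : nat} {s : 'I_N -> Q}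
  (s_inj : injective s) (V : lmodType R) (v : 'I_N -> V) (j : 'I_N) :
  \sum_(i < N) mode_vec R s (s j) i 0 *: v i = v j.
Proof.
rewrite (bigD1 j)//= big1 ?addr0 => [|i ij]; first by rewrite mxE eqxx scale1r.
by rewrite mxE (inj_eq s_inj) eq_sym (negbTE ij) scale0r.
Qed.

(** Continuity at t is only available from within [0, +oo[, so the rational
    number near t is taken to the right of t. *)
Lemma continuous_eq0_rat {R : realType} {f : R -> R} :
  {within `[0, +oo[, continuous f} ->
  (forall p : rat, 0 <= ratr p :> R -> f (ratr p) = 0) ->
  forall t : R, 0 <= t -> f t = 0.
Proof.
move=> /subspace_continuousP cf f0 t t0; apply/eqP/negPn/negP => ft0.
have tA : `[0, +oo[%classic t by rewrite /= in_itv /= t0.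
have : \forall u \near within `[0, +oo[ (nbhs t), f u != 0.
  apply: (cf t tA (fun y : R => y != 0)).
  by apply: open_nbhs_nbhs; split => //; exact: open_neq.
rewrite near_withinE => /nbhs_ballP[e /= e0 H].
have [p] := @rat_in_itvoo R t (t + e) ltac:(by rewrite ltrDl).
rewrite in_itv /= => /andP[tp pe].
have p0 : 0 <= ratr p :> R by exact: le_trans t0 (ltW tp).
have : f (ratr p) != 0.
  apply: H; last by rewrite /= in_itv /= p0.
  by rewrite /ball /= distrC gtr0_norm ?subr_gt0// ltrBlDl.
by rewrite f0// eqxx.
Qed.

(** Without steps, the evaluation and the integral of the process are empty
    sums.  Its constant values are adapted because a sigma-algebra contains
    the empty and the full set, the only preimages under a constant. *)
Lemma simple_process0 {R : realType} {d : measure_display}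
  {Omega : measurableType d} {F : R -> set_system Omega} (k : nat) :
  filtration F -> exists Y : simple_process F k, sp_size Y = 0%N.
Proof.
move=> Ffilt; have [F0 FC _] := filtration_sigma Ffilt (lexx 0).
have adapted (i : nat) (a : 'I_k) :
    meas_wrt (F 0) (fun _ : Omega => (0 : 'rV[R]_k) 0 a).
  move=> B _; rewrite (preimage_cst ((0 : 'rV[R]_k) 0 a)).
  case: ifP => _ //; rewrite -(setD0 [set: Omega]); exact: FC.
have bounded : exists C : R, forall (i : nat) (o : Omega) (a : 'I_k),
    `|(0 : 'rV[R]_k) 0 a| <= C.
  by exists 0 => _ _ a; rewrite mxE normr0.
by exists (@SimpleProcess R Omega F k 0 (fun=> 0) (fun _ _ => 0) (lexx 0)
  (fun=> lexx 0) adapted bounded).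
Qed.

Section ito_integral_zero.
Context {R : realType} {d : measure_display} {Omega : measurableType d}.
Context {P : probability Omega R} {F : R -> set_system Omega} {k : nat}.
Context {w : R -> Omega -> 'cV[R]_k}.

(** The integrals of every approximating sequence converge to M t, hence one
    sequence with known integrals determines M t almost surely. *)
Lemma ito_integral0_at {M : R -> Omega -> R} {t : R} :
  filtration F -> ito_integral P F w (fun _ _ => 0) M -> 0 <= t ->
  {ae P, forall o, M t o = 0}.
Proof.
move=> Ffilt ito t0; have [Y Y0] := simple_process0 k Ffilt.
have Y_approx : sp_approximates P (fun=> Y) (fun _ _ => 0).
  move=> u u0 eps eps0; rewrite [X in X @ _ --> _](_ : _ = fun=> 0%E).
    exact: cvg_cst.
  apply/funext => i; rewrite [X in P X](_ : _ = set0) ?measure0//.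
  apply/seteqP; split => // o /=; rewrite integral0_eq; last first.
    move=> v _; rewrite big1// => a _.
    rewrite /sp_eval; move: (sp_val Y) (sp_time Y); rewrite Y0 => V T.
    by rewrite big_ord0 !mxE subrr expr0n.
  by rewrite lte_fin ltNge (ltW eps0).
have intY o : sp_integral w Y t o = 0.
  by rewrite /sp_integral; move: (sp_val Y) (sp_time Y); rewrite Y0 => V T;
    rewrite big_ord0.
have mM := ito_rv ito t0.
(* The sequence converging to 0 in probability is constant. *)
have M_null (eps : R) : 0 < eps -> P [set o | (eps < `|M t o|)] = 0%E.
  move=> eps0; have := ito_limit ito Y_approx t0 eps0.
  rewrite (_ : (fun _ => _) = fun=> P [set o | (eps < `|M t o|)]).
    by move=> cvg0; apply: (cvg_unique _ (cvg_cst _) cvg0).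
  apply/funext => i; congr (P _); apply/seteqP.
  by split => o /=; rewrite intY sub0r normrN lte_fin.
have : {ae P, forall o, forall i : nat, `|M t o| <= i.+1%:R^-1}.
  apply: ae_foralln => i; have i0 : 0 < i.+1%:R^-1 :> R by rewrite invr_gt0.
  exists [set o | i.+1%:R^-1 < `|M t o|]; split => /=.
  - have := measurableT_comp (@measurable_realfun.normr_measurable R setT) mM.
    move=> /(_ measurableT `]i.+1%:R^-1, +oo[%classic (measurable_itv _)).
    rewrite setTI; congr (measurable _).
    by apply/seteqP; split => o /=; rewrite in_itv /= andbT.
  - exact: M_null.
  - by move=> o /= /negP; rewrite -ltNge.
apply: filterS => o M_le; apply/normr0_eq0/eqP; rewrite eq_le normr_ge0 andbT.
apply/ler_addgt0Pr => e e0; rewrite add0r.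
have [i ie] := ltr_add_invr e0.
by apply: le_trans (M_le i) _; rewrite -[leLHS]add0r ltW.
Qed.

Lemma ito_integral0 {M : R -> Omega -> R} :
  filtration F -> ito_integral P F w (fun _ _ => 0) M ->
  {ae P, forall o, forall t : R, 0 <= t -> M t o = 0}.
Proof.
move=> Ffilt ito.
have : {ae P, forall o, forall i : nat, forall p : rat, unpickle i = Some p ->
    0 <= ratr p :> R -> M (ratr p) o = 0}.
  apply: ae_foralln => i; case: (unpickle i) => [p|]; last exact: aeW.
  have [p0|p0] := boolP (0 <= ratr p :> R); last first.
    by apply: aeW => o _ [<-]; rewrite (negbTE p0).
  by apply: filterS (ito_integral0_at Ffilt ito p0) => o Mo _ [<-].
move=> ae_rat; apply: filterS2 (ito_continuous ito) ae_rat => o M_cont M_rat.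
apply: (continuous_eq0_rat M_cont) => p.
by apply: (M_rat (pickle p)); rewrite pickleK.
Qed.

(** This yields that b is constant between resets when applied, in the
    single-mode system, to the coordinates of b. *)
Lemma evolves_const_coord {Q : Type} {n m : nat} {H : shs R Q n k m}
  {T : Omega -> set R} {q : R -> Omega -> Q} {x : R -> Omega -> 'cV[R]_n}
  (a : 'I_n) :
  filtration F -> evolves_between_resets H P F w T q x ->
  (forall p y, drift H p y a 0 = 0) ->
  (forall p y, row a (diffusion H p y) = 0) ->
  {ae P, forall o, forall t1 t2 : R, 0 <= t1 -> t1 <= t2 ->
     T o `&` `]t1, t2] = set0 -> x t2 o a 0 = x t1 o a 0}.
Proof.
move=> Ffilt evol drift0 diff0; have [M ito incr] := evolves_state evol a.
have {}ito : ito_integral P F w (fun _ _ => 0) M.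
  rewrite [X in ito_integral _ _ _ X](_ : _ = fun _ _ => 0) in ito => //.
  by apply/funext => u; apply/funext => o; exact: diff0.
apply: filterS2 incr (ito_integral0 Ffilt ito).
move=> o {}incr M0 t1 t2 t1_ge0 t12 no_reset.
apply/eqP; rewrite -subr_eq0 incr// !M0 ?(le_trans t1_ge0)// subrr addr0.
rewrite /Rintegral integral0_eq// => u _; by rewrite drift0.
Qed.

End ito_integral_zero.

Theorem lemma2 (R : realType) (Q : eqType) (N n k m : nat)
  (s : 'I_N -> Q) (s_bij : bijective s) (H : shs R Q n k m)
  (intensity_ge0 : forall r q x, 0 <= intensity H r q x) :
  (forall (j : 'I_N) (x : 'cV[R]_n),
     let z := col_mx (mode_vec R s (s j)) x in
     [/\ drift (recast s H) tt z = col_mx 0 (drift H (s j) x),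
         diffusion (recast s H) tt z = col_mx 0 (diffusion H (s j) x),
         forall r : 'I_m,
           intensity (recast s H) r tt z = intensity H r (s j) x /\
           0 <= intensity (recast s H) r tt z
       & forall r : 'I_m,
           reset_state (recast s H) r tt z =
             col_mx (mode_vec R s (reset_mode H r (s j)))
                    (reset_state H r (s j) x)])
  /\
  (forall z : 'cV[R]_(N + n),
     usubmx (drift (recast s H) tt z) = 0 /\
     usubmx (diffusion (recast s H) tt z) = 0)
  /\
  (forall (d : measure_display) (Omega : measurableType d)
     (P : probability Omega R) (F : R -> set_system Omega)
     (w : R -> Omega -> 'cV[R]_k) (T : Omega -> set R)
     (b : R -> Omega -> 'cV[R]_N) (x : R -> Omega -> 'cV[R]_n),
     wiener_process P F w ->
     evolves_between_resets (recast s H) P F w T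
       (fun _ _ => tt) (fun t o => col_mx (b t o) (x t o)) ->
     {ae P, forall o, forall t1 t2 : R, 0 <= t1 -> t1 <= t2 ->
        T o `&` `]t1, t2] = set0 -> b t2 o = b t1 o}).
Proof.
have s_inj := bij_inj s_bij.
have drift_diffusion0 (z : 'cV[R]_(N + n)) :
    usubmx (drift (recast s H) tt z) = 0 /\
    usubmx (diffusion (recast s H) tt z) = 0.
  by split; rewrite /= col_mxKu.
split; [|split=> //].
  move=> j x z.
  have intensityE r : intensity (recast s H) r tt z = intensity H r (s j) x.
    rewrite /= /z col_mxKu col_mxKd.
    exact: (sum_mode_vec s_inj R^o (fun i => intensity H r (s i) x)).
  split=> [||r|r]; first 2 last.
  - by split; rewrite intensityE.
  - by rewrite /= /z col_mxKu col_mxKd !sum_mode_vec// subrr add0r.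
  - by rewrite /= /z col_mxKu col_mxKd sum_mode_vec.
  - by rewrite /= /z col_mxKu col_mxKd sum_mode_vec.
move=> d Omega P F w T b x wP evol.
have : {ae P, forall o, forall i : 'I_N, forall t1 t2 : R, 0 <= t1 -> t1 <= t2 ->
    T o `&` `]t1, t2] = set0 -> b t2 o i 0 = b t1 o i 0}.
  apply: filter_forall => i.
  have Ffilt := wiener_filtration wP.
  apply: filterS (evolves_const_coord (lshift n i) Ffilt evol _ _).
  - move=> o const t1 t2 t1_ge0 t12 no_reset.
    by have := const t1 t2 t1_ge0 t12 no_reset; rewrite !col_mxEu.
  - by move=> [] z; rewrite /= col_mxEu mxE.
  - by move=> [] z; apply/rowP => c; rewrite mxE /= col_mxEu !mxE.
apply: filterS => o b_const t1 t2 t1_ge0 t12 no_reset.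
by apply/colP => i; exact: b_const.
Qed.
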